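(* The three-dimensional LLS sequence is an integer invariant of prismatic diagrams (and hence also of Farey polyhedra). That is, let $P$ and $P'$ be Farey polyhedra in $\mathbb Z^3$ defined by finite continued fractions. If the canonical prismatic flag diagrams of $P$ and $P'$ coincide, then for every $j\in\{1,2,3\}$ the LLS sequence of the $j$-th sail of $P$ coincides with the LLS sequence of the $j$-th sail of $P'$. Consequently, if an integer affine transformation maps $P$ to $P'$, preserving the Farey simplices and their order and the enumeration of the masts, then the LLS sequences of the corresponding sails of $P$ and $P'$ coincide.
   Context: **Farey polyhedra.** Start with $V_1,V_2,V_3$ equal to the standard basis vectors of $\mathbb Z^3$, all indices $1,2,3$ active. A step at an active index $c$ replaces $V_c$ by $V_c'=\sum_{i\text{ active}}V_i$ and produces the Farey simplex with vertices the old $V_c$, the new $V_c'$ and the other active $V_i$. A finite continued fraction $[a_1;a_2:\cdots:a_k\,|\,b_1:\cdots:b_l]$ encodes: $a_1$ steps at index $1$, $a_2$ at index $2$, $a_3$ at index $3$, $a_4$ at index $1$, and so on cyclically; then (at ''$|$'') one index is made inactive (its mast is dropped, and the dimension drops), the remaining two being $s\equiv k+1$, $t\equiv k+2 \pmod 3$; then $b_1$ steps at $s$, $b_2$ at $t$, $b_3$ at $s$, and so on. The Farey polyhedron is the union of these Farey simplices, with this subdivision and order. The $i$-th yard $T_i$ is the simplex on the active $V$'s after step $i$ (after dropping, if a drop takes place at step $i$); $T_0$ is the deck (the triangle on the basis vectors), the last yard is the nest. The $j$-th mast is the broken line through the successive positions of $V_j$; its edges are mast edges. **Prismatic flag diagram.**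 The canonical prismatic flag diagram of a Farey polyhedron is the combinatorially identical ordered simplicial complex in which every mast edge on mast $j$ is replaced by a translate of the vector $(1,1,1)$: mast $j$ lies on the line through the $j$-th basis vector in direction $(1,1,1)$, starting at that basis vector, and consecutive vertices of the mast differ by $(1,1,1)$. **Principal yards and division simplices.** The deck and the nest are principal; any other yard $T_i$ is principal if the dimension drops at $T_i$ (i.e. $\dim T_i<\dim T_{i-1}$) or if the index at which step $i+1$ is made differs from the index at which step $i$ is made. A division simplex is the convex hull of two consecutive principal yards; it is a simplex and is the union of the Farey simplices between them. **Sails.** The $j$-th sail of the canonical prismatic flag diagram is its intersection with the plane spanned by $(1,1,1)$ and the edge of the deck not containing the $j$-th deck vertex; the $j$-th sail of the Farey polyhedron is the corresponding subcomplex, i.e. the union of all faces of Farey simplices with no vertex on the dropped-out mast $j$ (all vertices on the other two masts). Let $F_i$ be the intersection of a sail with the division simplex $D_i$. $F_i$ is a principal face of the sail if $\dim F_i\ge\dim D_i-1$. Principal faces are ordered by the order of the division simplices. A mast segment is a maximal union of collinear consecutive mast edges. **Integer invariants.** The integer length of a segment with integer endpoints is the number of integer points in its interior plus one. For a linearly independent family $X$ of integer vectors, $\mathrm{lV}(X)$ is the index of the sublattice it generates in the lattice of all integer vectors of its linear span ($\mathrm{lV}(\emptyset)=1$). For two integer (affine) spaces $\pi_1,\pi_2$ meeting in an integer space, take lattice bases $P_1,P_2$ of their direction lattices such that $W=P_1\cap P_2$ is a lattice basis of the direction lattice of $\pi_1\cap\pi_2$, and put $U=P_1\setminus W$, $V=P_2\setminus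 W$; the integer sine is $\mathrm{lsin}(\pi_1,\pi_2)=\dfrac{\mathrm{lV}(V,U,W)}{\mathrm{lV}(V)\,\mathrm{lV}(U)\,\mathrm{lV}(W)}$. If the principal faces lie in the same plane the integer sine is set to be $0$. An integer affine transformation is an affine map preserving $\mathbb Z^3$. **LLS sequence.** The LLS sequence of the $j$-th sail of the Farey polyhedron is the $j$-th sail of its canonical prismatic flag diagram equipped with: (1) for each pair of consecutive principal faces, the integer sine between the planes (spaces) that these faces span in the Farey polyhedron, placed at the principal yard edge connecting the two faces; (2) a mark (double yard edge) where the $j$-th mast is dropped; (3) for each mast segment, its integer length (the segment being drawn as a single unit segment with this number). *)

(* Defs.v *)
From mathcomp Require Import all_boot all_order all_algebra finmap.
From mathcomp Require Import boolp classical_sets functions cardinality reals.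

Set Implicit Arguments.
Unset Strict Implicit.
Unset Printing Implicit Defensive.

Import Order.TTheory GRing.Theory Num.Theory.

Local Open Scope fset_scope.
Local Open Scope classical_set_scope.
Local Open Scope ring_scope.

(* Indices are 0-based: the masts 1, 2, 3 of the text are 0, 1, 2 : 'I_3.     *)

(** * Finite continued fractions [a_1; a_2 : ... : a_k | b_1 : ... : b_l] *)

(* Entries may be 0: zeros are needed to encode, e.g., a step at index 1      *)
(* followed by a step at index 3.  Some step precedes the drop (the deck is a *)
(* triangle).  [cf_drop_visible] excludes only the fractions with no step     *)
(* after the drop and a_k = 0: for these the Farey simplices do not see which *)
(* mast is dropped.  It holds whenever a_k > 0 or some b_i > 0.               *)
Record cfrac := CFrac {
  cf_a : seq nat;
  cf_b : seq nat;
  cf_a_step : (0 < sumn cf_a)%N;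
  cf_drop_visible : (0 < last 0%N cf_a)%N || (0 < sumn cf_b)%N
}.

Definition cyc (i : nat) : 'I_3 := inord (i %% 3).

Section FareyPolyhedron.
Variable P : cfrac.

(* The 1-based index of the a_i-steps is i mod 3; after the drop the b_i-steps *)
(* alternate between s = k+1 and t = k+2 (mod 3).                              *)
Definition word : seq 'I_3 :=
  flatten [seq nseq (nth 0%N (cf_a P) i) (cyc i) | i <- iota 0 (size (cf_a P))]
  ++ flatten [seq nseq (nth 0%N (cf_b P) i) (cyc (size (cf_a P) + i %% 2))
             | i <- iota 0 (size (cf_b P))].

Definition nsteps : nat := size word.
Definition drop_time : nat := sumn (cf_a P).
Definition dropped : 'I_3 := cyc (size (cf_a P)).+2.

(* Step [i] leads from the yard T_i to T_{i+1}; it is the (i+1)-st step.       *)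
Definition step_index (i : nat) : 'I_3 := nth ord0 word i.

Definition active (i : nat) : {set 'I_3} :=
  if (i < drop_time)%N then [set: 'I_3]%SET else [set~ dropped]%SET.

Fixpoint V (i : nat) (j : 'I_3) : 'rV[int]_3 :=
  if i is i'.+1 then
    if j == step_index i' then \sum_(p in active i') V i' p else V i' j
  else delta_mx 0 j.

(* Successive positions of V_j: the vertices of the broken line "mast j".      *)
Definition mast (j : 'I_3) : seq 'rV[int]_3 :=
  V 0 j :: [seq V i.+1 j | i <- iota 0 nsteps & step_index i == j].

Definition moves (i : nat) (j : 'I_3) : nat := count_mem j (take i word).

End FareyPolyhedron.

(* The vertex (j, m) is the m-th vertex of mast j, the 0-th one being on the  *)
(* deck.  The Farey polyhedron and its prismatic diagram are two realizations *)
(* of one complex on these vertices.                                          *)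
Definition vertex := ('I_3 * nat)%type.

Section Complex.
Variable P : cfrac.

Definition yard (i : nat) : {fset vertex} :=
  [fset (j, moves P i j) | j in active P i].

Definition simplex (i : nat) : {fset vertex} :=
  ((step_index P i, moves P i.+1 (step_index P i)) |` yard i)%fset.

Definition farey_pos (v : vertex) : 'rV[int]_3 := nth 0 (mast P v.1) v.2.

Definition prism_pos (v : vertex) : 'rV[int]_3 :=
  delta_mx 0 v.1 + const_mx v.2%:Z.

Definition realize (pos : vertex -> 'rV[int]_3) (S : {fset vertex}) :
  {fset 'rV[int]_3} := [fset pos v | v in S].

Definition farey_polyhedron : seq {fset 'rV[int]_3} :=
  [seq realize farey_pos (simplex i) | i <- iota 0 (nsteps P)].

Definition prismatic_diagram : seq {fset 'rV[int]_3} :=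
  [seq realize prism_pos (simplex i) | i <- iota 0 (nsteps P)].

(* dim T = #|` T| - 1 for a yard T. *)
Definition principal_yard (i : nat) : bool :=
  [|| i == 0%N, i == nsteps P, (#|` yard i | < #|` yard i.-1 |)%N
    | step_index P i != step_index P i.-1].

Definition principal_yards : seq nat :=
  [seq i <- iota 0 (nsteps P).+1 | principal_yard i].

(* Pairs (i, m) such that T_i and T_m are consecutive principal yards. *)
Definition divisions : seq (nat * nat) :=
  zip principal_yards (behead principal_yards).

(* The later yard is taken before a drop at step m.  This matters only when   *)
(* the mast that has just moved is dropped: the convex hull of T_i and the    *)
(* dropped T_m would then be T_i, not the union of the Farey simplices        *)
(* between them.                                                              *)
Definition division_simplex (D : nat * nat) : {fset vertex} :=
  (yard D.1 `|` [fset (j, moves P D.2 j) | j in active P D.1])%fset.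

Definition off_mast (j : 'I_3) (S : {fset vertex}) : {fset vertex} :=
  [fset v in S | v.1 != j].

End Complex.

(** * Real geometry *)

Section Geometry.
Variable R : realType.
Implicit Types A B : set 'rV[R]_3.

Definition toR (z : 'rV[int]_3) : 'rV[R]_3 := map_mx intr z.

Definition convex_hull (S : {fset 'rV[int]_3}) : set 'rV[R]_3 :=
  [set x | exists w : 'rV[int]_3 -> R,
     [/\ forall v, v \in S -> 0 <= w v, \sum_(v <- S) w v = 1
       & x = \sum_(v <- S) w v *: toR v]].

Definition affine_hull A : set 'rV[R]_3 :=
  [set x | exists n (p : 'I_n -> 'rV[R]_3) (w : 'I_n -> R),
     [/\ forall i, A (p i), \sum_i w i = 1 & x = \sum_i w i *: p i]].

(* The largest d such that A contains d + 1 affinely independent points. *)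
Definition dim A : nat :=
  \max_(d < 4 | `[< exists x (M : 'M[R]_(d, 3)),
                      [/\ A x, row_free M & forall i, A (x + row i M)] >]) d.

(** * Integer invariants *)

Definition integer_length (u v : 'rV[int]_3) : nat :=
  #|` fset_set [set z : 'rV[int]_3 | exists t : R,
        0 < t < 1 /\ toR z = (1 - t) *: toR u + t *: toR v] |.+1.

Implicit Types X : seq 'rV[int]_3.

Definition family_mx X : 'M[int]_(size X, 3) := \matrix_(i < size X) X`_i.

Definition independent X : Prop :=
  row_free (map_mx (intr : int -> R) (family_mx X)).

Definition zspan X : set 'rV[int]_3 :=
  [set z | exists c : 'rV[int]_(size X), z = c *m family_mx X].

Definition span_lattice X : set 'rV[int]_3 :=
  [set z | (toR z <= map_mx (intr : int -> R) (family_mx X))%MS].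

(* The number of cosets of [zspan X] in [span_lattice X]. *)
Definition lV X : nat :=
  #|` fset_set [set [set z + y | y in zspan X] | z in span_lattice X] |.

Definition direction_lattice A : set 'rV[int]_3 :=
  [set z | exists2 x, A x & A (x + toR z)].

Definition lattice_basis (L : set 'rV[int]_3) X : Prop :=
  independent X /\ zspan X = L.

(* The quotient does not depend on the bases chosen; [xget] selects its value. *)
Definition lsin A B : rat :=
  xget 0 [set s | exists P1 P2 : seq 'rV[int]_3,
    let W := [seq x <- P1 | x \in P2] in
    let U := [seq x <- P1 | x \notin P2] in
    let V := [seq x <- P2 | x \notin P1] in
    [/\ lattice_basis (direction_lattice A) P1,
        lattice_basis (direction_lattice B) P2,
        lattice_basis (direction_lattice (A `&` B)) W
      & s = (lV (V ++ U ++ W))%:R / ((lV V)%:R * (lV U)%:R * (lV W)%:R)]].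

(* Sine between the spaces spanned by two faces; it is 0 when one of these    *)
(* spaces contains both faces.  If one face is two-dimensional this says that *)
(* the faces lie in one plane.  Two edges with a common vertex always lie in  *)
(* one plane; their sine is set to 0 only if they span the same line.         *)
Definition face_sine A B : rat :=
  if `[< A `<=` affine_hull B \/ B `<=` affine_hull A >] then 0
  else lsin (affine_hull A) (affine_hull B).

(** * Sails *)

Definition sail_plane (j : 'I_3) : set 'rV[R]_3 :=
  affine_hull [set x | exists2 p : 'I_3, p != j &
    x = toR (delta_mx 0 p) \/ x = toR (delta_mx 0 p) + const_mx 1].

Section LLS.
Variables (P : cfrac) (j : 'I_3).

(* The complex cut out on the plane, in the order of the simplices. *)
Definition prismatic_sail : seq (set 'rV[R]_3) :=
  [seq convex_hull T `&` sail_plane j | T <- prismatic_diagram P].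

Definition farey_sail : set 'rV[R]_3 :=
  [set x | exists i (G : {fset vertex}),
    [/\ (i < nsteps P)%N, (G `<=` simplex P i)%fset,
        forall v, v \in G -> v.1 != j
      & convex_hull (realize (farey_pos P) G) x]].

Definition division_set (D : nat * nat) : set 'rV[R]_3 :=
  convex_hull (realize (farey_pos P) (division_simplex P D)).

Definition sail_face (D : nat * nat) : set 'rV[R]_3 :=
  farey_sail `&` division_set D.

(* Principal faces, given by their division simplices. *)
Definition principal_faces : seq (nat * nat) :=
  [seq D <- divisions P | ((dim (division_set D)).-1 <= dim (sail_face D))%N].

Definition yard_edge (i : nat) : {fset 'rV[int]_3} :=
  realize prism_pos (off_mast j (yard P i)).

(* The trace on the sail of the first yard of D.2's division simplex is the   *)
(* common part of the two faces.                                              *)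
Definition sines : seq ({fset 'rV[int]_3} * rat) :=
  [seq (yard_edge D.2.1, face_sine (sail_face D.1) (sail_face D.2))
  | D <- zip principal_faces (behead principal_faces)].

Definition drop_mark : option {fset 'rV[int]_3} :=
  if dropped P == j then Some (yard_edge (drop_time P)) else None.

End LLS.

Definition collinear A : Prop :=
  exists x u, A `<=` [set x + t *: u | t in [set: R]].

Section MastSegments.
Variables (P : cfrac) (p : 'I_3).

Definition collinear_part (m n : nat) : Prop :=
  collinear [set toR (farey_pos P (p, i)) | i in [set i | (m <= i <= n)%N]].

Definition mast_segment (m n : nat) : Prop :=
  [/\ (m < n < size (mast P p))%N, collinear_part m n,
      (0 < m)%N -> ~ collinear_part m.-1 n
    & (n.+1 < size (mast P p))%N -> ~ collinear_part m n.+1].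

Definition mast_segments : seq (nat * nat) :=
  [seq s <- [seq (m, n) | m <- iota 0 (size (mast P p)),
                          n <- iota 0 (size (mast P p))]
  | `[< mast_segment s.1 s.2 >]].

End MastSegments.

(* Mast segments are located by their end points in the prismatic diagram. *)
Definition lengths (P : cfrac) (j : 'I_3) :
    seq (('rV[int]_3 * 'rV[int]_3) * nat) :=
  [seq ((prism_pos (p, s.1), prism_pos (p, s.2)),
        integer_length (farey_pos P (p, s.1)) (farey_pos P (p, s.2)))
  | p <- [seq p <- enum 'I_3 | p != j], s <- mast_segments P p].

Record LLS_sequence := LLSSequence {
  LLS_sail : seq (set 'rV[R]_3);
  LLS_sines : seq ({fset 'rV[int]_3} * rat);
  LLS_mark : option {fset 'rV[int]_3};
  LLS_lengths : seq (('rV[int]_3 * 'rV[int]_3) * nat)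
}.

Definition LLS (P : cfrac) (j : 'I_3) : LLS_sequence :=
  LLSSequence (prismatic_sail P j) (sines P j) (drop_mark P j) (lengths P j).

(** * Integer affine transformations *)

Definition integer_affine (f : 'rV[R]_3 -> 'rV[R]_3) : Prop :=
  (exists (A : 'M[R]_3) (b : 'rV[R]_3), forall x, f x = x *m A + b) /\
  f @` range toR = range toR.

(* f maps the i-th Farey simplex of P to the i-th one of P', and mast j of P  *)
(* to mast j of P'; simplices and masts are given by their vertices.          *)
Definition maps_farey (f : 'rV[R]_3 -> 'rV[R]_3) (P P' : cfrac) : Prop :=
  [seq f @` (toR @` [set` T]) | T <- farey_polyhedron P] =
    [seq toR @` [set` T] | T <- farey_polyhedron P'] /\
  forall j : 'I_3,
    f @` (toR @` [set` mast P j]) = toR @` [set` mast P' j].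

End Geometry.

(* Main.v *)
Require Import Defs.
From mathcomp Require Import all_boot all_order all_algebra.
From mathcomp Require Import finmap zify.
From mathcomp Require Import boolp classical_sets reals.

(** The whole LLS sequence is computed from three data of the fraction: the
    word of step indices, the drop time and the dropped index ([LLS_ext]).  All
    three can be recovered by counting, for each Farey simplex, its vertices on
    each mast ([LLS_determined]): the index at which the step is made is the
    only one with two vertices, the other active indices have one, and an
    inactive index has none.  So the word and the activity before each step are
    known.  If some step follows the drop, its simplex shows when the drop
    happens and which mast goes.  If no step follows, the drop takes place after
    the last step, and the last index of the word is the dropped one.

    The counts are visible in the prismatic diagram because distinct vertices
    have distinct positions there ([prism_pos_inj]).  They are visible in the
    Farey polyhedron as numbers of points of a simplex on a mast, provided that
    different masts have no common point and that the vertices of a simplex are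
    distinct ([farey_mast_count]).  Both follow from linear algebra: the three
    current vertices, with the dropped one left where it was, always form a
    basis, and a later vertex of mast [j] is a combination of an earlier basis
    with nonnegative coefficients, the one on [V_j] being at least 1
    ([V_later]); hence it cannot be equal to an earlier vertex of another mast.
    An integer affine map is a bijection, so it preserves these counts when it
    respects the simplices and the masts. *)

Set Implicit Arguments.
Unset Strict Implicit.
Unset Printing Implicit Defensive.

Import Order.TTheory GRing.Theory Num.Theory.

Local Open Scope ring_scope.

(** * The word of a fraction *)

Lemma cyc_eq (m n : nat) : (cyc m == cyc n) = (m == n %[mod 3]).
Proof. by rewrite -val_eqE /= !inordK ?ltn_mod. Qed.

Lemma flatten_nseq_shape (T : Type) (s : seq nat) (c : nat -> T) :
  size (flatten [seq nseq (nth 0 s i) (c i) | i <- iota 0 (size s)])%N = sumn s.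
Proof.
rewrite size_flatten /shape -map_comp; congr sumn.
rewrite -[RHS](mkseq_nth 0%N); apply: eq_map => i /=; exact: size_nseq.
Qed.

Section Word.
Variable P : cfrac.

Lemma nstepsE : nsteps P = (drop_time P + sumn (cf_b P))%N.
Proof. by rewrite /nsteps size_cat !flatten_nseq_shape. Qed.

Lemma drop_time_le : (drop_time P <= nsteps P)%N.
Proof. by rewrite nstepsE leq_addr. Qed.

Lemma step_index_active i : (i < nsteps P)%N -> step_index P i \in active P i.
Proof.
move=> lti; rewrite /active; case: ltnP => [|lei]; first by rewrite inE.
rewrite /step_index /word nth_cat flatten_nseq_shape ltnNge lei /=.
set w := flatten _.
have : nth ord0 w (i - sumn (cf_a P)) \in w.
  by rewrite mem_nth // flatten_nseq_shape ltn_subLR // -nstepsE.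
move=> /flattenP[s /mapP[m _ ->]]; rewrite mem_nseq => /andP[_ /eqP ->].
by rewrite !inE cyc_eq; have := ltn_mod m 2; lia.
Qed.

(** The sum taken at a step always has a summand other than the vertex
    replaced, even when only two indices are active. *)
Lemma active_other i j : exists2 k, k != j & k \in active P i.
Proof.
rewrite /active; case: ltnP => _.
  exists (if j == ord0 then lift ord0 ord0 else ord0); last by rewrite inE.
  by case: (eqVneq j ord0) => [->|]; rewrite // eq_sym.
have /card_gt0P[k] : (0 < #|~: [set j; dropped P]|)%N.
  have := cardsC [set j; dropped P]; rewrite card_ord cards2; lia.
by rewrite !inE negb_or => /andP[nj nd]; exists k; rewrite // !inE.
Qed.

(** If no step follows the drop then [a_k > 0], so the last step is made at
    index [k]; the dropped mast has index [k + 3], the same modulo 3. *)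
Lemma dropped_last_step : drop_time P = nsteps P -> dropped P = last ord0 (word P).
Proof.
rewrite nstepsE => /eqP; rewrite -{1}[drop_time P]addn0 eqn_add2l eq_sym => /eqP b0.
have := cf_drop_visible P; rewrite b0 orbF /dropped /word => lasta.
have -> : flatten [seq nseq (nth 0 (cf_b P) i) (cyc (size (cf_a P) + i %% 2))
             | i <- iota 0 (size (cf_b P))]%N = [::].
  by apply/nilP; rewrite /nilp flatten_nseq_shape b0.
rewrite cats0; case/lastP: (cf_a P) lasta => [//|a x]; rewrite last_rcons => x0.
rewrite size_rcons -(addn1 (size a)) iotaD map_cat flatten_cat /= cats0 add0n.
rewrite nth_rcons ltnn eqxx last_cat; case: x x0 => // x _.
have lastE (c : 'I_3) : last c (nseq x c) = c by elim: x => /=.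
rewrite /= lastE.
by apply/eqP; rewrite cyc_eq; lia.
Qed.

End Word.

(** * What the Farey simplices show *)

Definition mast_count (P : cfrac) (i : nat) (j : 'I_3) : nat :=
  #|` [fset v in simplex P i | v.1 == j]%fset|.

Lemma moves_step P i j : (i < nsteps P)%N ->
  moves P i.+1 j = (moves P i j + (step_index P i == j))%N.
Proof.
by move=> lti; rewrite /moves (take_nth ord0) // -cats1 count_cat /= addn0.
Qed.

Lemma mem_yard P i v :
  (v \in yard P i) = (v.1 \in active P i) && (v.2 == moves P i v.1).
Proof.
apply/imfsetP/andP => [[j /= ja ->]|[]]; first by [].
by case: v => j m /= ja /eqP ->; exists j.
Qed.

Lemma mem_simplex P i v : (i < nsteps P)%N ->
  (v \in simplex P i) = (v.1 \in active P i) &&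
    ((v.2 == moves P i v.1) ||
      (v.1 == step_index P i) && (v.2 == moves P i.+1 v.1)).
Proof.
move=> lti; rewrite in_fset1U mem_yard andb_orr orbC; congr orb.
case: v => j m; rewrite -pair_eqE /=; case: (eqVneq j) => [->|]; last by rewrite andbF.
by rewrite step_index_active.
Qed.

Lemma in_fset_sep (T : choiceType) (A : {fset T}) (p : pred T) x :
  (x \in [fset y in A | p y]%fset) = p x && (x \in A).
Proof. by rewrite in_fset; exact: andbC. Qed.

Lemma card_image_fset (T K : choiceType) (f : T -> K) (A : {fset T}) :
  {in A &, injective f} -> #|` [fset f x | x in A]%fset| = #|` A|.
Proof. by move=> f_inj; rewrite card_in_imfset. Qed.

(** The simplex contains the active vertices and the one new vertex. *)
Lemma mast_countE P i j : (i < nsteps P)%N ->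
  mast_count P i j = ((j \in active P i) + (j == step_index P i))%N.
Proof.
move=> lti; have ca := step_index_active lti; rewrite /mast_count.
have [ja|ja] := boolP (j \in active P i); last first.
  rewrite [X in #|` X|](_ : _ = fset0) ?cardfs0.
    by case: eqVneq ja => // ->; rewrite ca.
  apply/fsetP => -[k m]; rewrite in_fset_sep in_fset0 mem_simplex //=.
  by case: eqVneq => //= ->; rewrite (negbTE ja).
have [ejc|njc] := eqVneq j (step_index P i).
  rewrite [X in #|` X|](_ : _ = [fset (j, moves P i j); (j, moves P i.+1 j)]%fset).
    by rewrite cardfs2 -pair_eqE /= eqxx moves_step // ejc eqxx; lia.
  apply/fsetP => -[k m]; rewrite in_fset_sep mem_simplex // !inE -!pair_eqE /=.
  by case: eqVneq => //= ->; rewrite ja ejc eqxx.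
rewrite [X in #|` X|](_ : _ = [fset (j, moves P i j)]%fset) ?cardfs1 //.
apply/fsetP => -[k m]; rewrite in_fset_sep mem_simplex // !inE -!pair_eqE /=.
by case: eqVneq => //= ->; rewrite ja (negbTE njc) orbF.
Qed.

Section Determined.
Variables P P' : cfrac.
Hypothesis eqn : nsteps P = nsteps P'.
Hypothesis eqc : forall i, (i < nsteps P)%N -> mast_count P i =1 mast_count P' i.

Let eqc_active i : (i < nsteps P)%N -> active P i = active P' i.
Proof.
move=> lti; apply/setP => j; have := eqc lti j; rewrite !mast_countE -?eqn //.
have ca : j = step_index P i -> j \in active P i.
  by move=> ->; exact: step_index_active.
have ca' : j = step_index P' i -> j \in active P' i.
  by move=> ->; apply: step_index_active; rewrite -eqn.
by case: eqP => [/ca ->|_]; case: eqP => [/ca' ->|_]; do ?case: (_ \in _).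
Qed.

Let eqc_step i : (i < nsteps P)%N -> step_index P i = step_index P' i.
Proof.
move=> lti; have := eqc lti (step_index P i); rewrite !mast_countE -?eqn //.
by rewrite -eqc_active // => /addnI; rewrite eqxx; case: eqP.
Qed.

Lemma word_determined : word P = word P'.
Proof. by apply: (@eq_from_nth _ ord0) => // i /eqc_step. Qed.

(** Otherwise, at the drop time of [Q'], an index is inactive for [Q'] while all
    are active for [Q]. *)
Let not_before (Q Q' : cfrac) : nsteps Q = nsteps Q' ->
  (forall i, (i < nsteps Q)%N -> active Q i = active Q' i) ->
  (drop_time Q <= drop_time Q')%N.
Proof.
move=> en ea; rewrite leqNgt; apply/negP => lt.
have /ea := leq_trans lt (drop_time_le Q).
rewrite /active lt ltnn => /setP/(_ (dropped Q')); by rewrite !inE eqxx.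
Qed.

Lemma drop_time_determined : drop_time P = drop_time P'.
Proof.
by apply/eqP; rewrite eqn_leq !not_before // => i; rewrite -eqn => /eqc_active.
Qed.

Lemma dropped_determined : dropped P = dropped P'.
Proof.
have := drop_time_le P; rewrite leq_eqVlt => /orP[/eqP eP|lt].
  rewrite !dropped_last_step ?word_determined // -drop_time_determined.
  by rewrite eP eqn.
have := eqc_active lt; rewrite /active -drop_time_determined ltnn.
by move=> /finset.setC_inj/finset.set1_inj.
Qed.

End Determined.

(** The yards, the simplices and the positions of their vertices are built from
    these three data, and the sails, sines, mark and lengths from the yards, the
    simplices and the positions. *)
Lemma LLS_ext (R : realType) (P P' : cfrac) (j : 'I_3) :
  word P = word P' -> drop_time P = drop_time P' -> dropped P = dropped P' ->
  LLS R P j = LLS R P' j.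
Proof.
move=> ew et ed.
have ea : active P = active P' by apply/funext => i; rewrite /active et ed.
have eV : V P = V P'.
  apply/funext => i; elim: i => //= i IH; apply/funext => k.
  by rewrite IH ea /step_index ew.
have em : mast P = mast P'.
  by apply/funext => k; rewrite /mast eV /nsteps /step_index ew.
have emv : moves P = moves P'.
  by do 2 apply/funext => ?; rewrite /moves ew.
have en : nsteps P = nsteps P' by rewrite /nsteps ew.
have es : step_index P = step_index P'.
  by apply/funext => ?; rewrite /step_index ew.
have ey : yard P = yard P' by apply/funext => i; rewrite /yard ea emv.
have esi : simplex P = simplex P'.
  by apply/funext => i; rewrite /simplex ey es emv.
have ef : farey_pos P = farey_pos P' by apply/funext => v; rewrite /farey_pos em.
have ep : principal_yard P = principal_yard P'.
  by apply/funext => i; rewrite /principal_yard en ey es.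
have edv : divisions P = divisions P'.
  by rewrite /divisions /principal_yards ep en.
have eds : division_simplex P = division_simplex P'.
  by apply/funext => D; rewrite /division_simplex ey ea emv.
have efs : @farey_sail R P = @farey_sail R P'.
  by apply/funext => k; rewrite /farey_sail ef en esi.
have edS : @division_set R P = @division_set R P'.
  by apply/funext => D; rewrite /division_set ef eds.
have esf : @sail_face R P = @sail_face R P'.
  by do 2 apply/funext => ?; rewrite /sail_face efs edS.
have eye : yard_edge P = yard_edge P'.
  by do 2 apply/funext => ?; rewrite /yard_edge ey.
have ems : mast_segments R P = mast_segments R P'.
  apply/funext => p; rewrite /mast_segments em; apply: eq_filter => -[m n].
  by rewrite /mast_segment /collinear_part ef em.
congr LLSSequence.
- by rewrite /prismatic_sail /prismatic_diagram en esi.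
- by rewrite /sines /principal_faces edv edS esf eye.
- by rewrite /drop_mark ed et eye.
- by rewrite /lengths ems ef.
Qed.

Lemma LLS_determined (R : realType) (P P' : cfrac) (j : 'I_3) :
  nsteps P = nsteps P' ->
  (forall i, (i < nsteps P)%N -> mast_count P i =1 mast_count P' i) ->
  LLS R P j = LLS R P' j.
Proof.
move=> eqn eqc; apply: LLS_ext; first exact: word_determined.
  exact: drop_time_determined.
exact: dropped_determined.
Qed.

(** * Prismatic diagrams *)

(** The three vertical lines are distinct because the difference of two basis
    vectors is not a multiple of [(1,1,1)]. *)
Lemma prism_pos_inj : injective prism_pos.
Proof.
move=> [j m] [k n] /rowP e.
have E i : (i == j)%:R + m%:Z = (i == k)%:R + n%:Z.
  by have := e i; rewrite !mxE /=.
have := E j; have := E k; rewrite !eqxx eq_sym.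
by case: eqVneq => [->|_] h1 h2; [congr pair|]; lia.
Qed.

Lemma prismatic_mast_count (P P' : cfrac) :
  prismatic_diagram P = prismatic_diagram P' ->
  nsteps P = nsteps P' /\
  forall i, (i < nsteps P)%N -> mast_count P i =1 mast_count P' i.
Proof.
move=> e; have en : nsteps P = nsteps P'.
  by have := congr1 size e; rewrite !size_map !size_iota.
split=> // i lti j; rewrite /mast_count.
have := congr1 (fun s => nth fset0 s i) e.
rewrite /prismatic_diagram !(nth_map 0%N) ?size_iota -?en // !nth_iota -?en //.
rewrite add0n => /fsetP er; suff -> : simplex P i = simplex P' i by [].
apply/fsetP => v; have := er (prism_pos v).
by rewrite /realize !mem_imfset //; exact: prism_pos_inj.
Qed.

(** * Masts of a Farey polyhedron *)

Section Masts.
Variable P : cfrac.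

Lemma movesE i j : (i <= nsteps P)%N ->
  moves P i j = size [seq m <- iota 0 i | step_index P m == j].
Proof.
move=> lei; rewrite /moves -(map_nth_iota0 ord0) // count_map size_filter.
by apply: eq_count => m /=; rewrite /step_index.
Qed.

(** Links the two descriptions of a vertex, by its rank on the mast and by the
    time at which it is the position of [V_j].  The bound makes it a true point
    of the mast, as opposed to the default value of [nth]. *)
Lemma mast_nth i j : (i <= nsteps P)%N ->
  (moves P i j < size (mast P j))%N /\ farey_pos P (j, moves P i j) = V P i j.
Proof.
rewrite /farey_pos /=; elim: i => [|i IH] lti; first by rewrite /moves take0.
have [IHs IHe] := IH (ltnW lti); rewrite moves_step //=.
case: eqVneq => [ej|_]; last by rewrite addn0.
rewrite addn1 /=; have mi := movesE j (ltnW lti).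
have -> : iota 0 (nsteps P) = iota 0 i ++ i :: iota i.+1 (nsteps P - i.+1).
  by rewrite -[RHS]/(iota 0 i ++ iota i (nsteps P - i.+1).+1) -iotaD subnSK // subnKC // ltnW.
rewrite filter_cat map_cat /= ej eqxx /= nth_cat !size_cat !size_map -mi ltnn subnn /=.
by split; [lia | rewrite ej eqxx].
Qed.

Lemma mem_mast j x : x \in mast P j -> exists2 i, (i <= nsteps P)%N & x = V P i j.
Proof.
rewrite inE => /predU1P[->|]; first by exists 0%N.
by case/mapP => i; rewrite mem_filter mem_iota => /andP[_ lti] ->; exists i.+1.
Qed.

(** A dropped vertex keeps its row, so that the rows remain a basis and yards
    before and after the drop can be compared. *)
Definition yard_mx (i : nat) : 'M[int]_3 := \matrix_(j < 3) V P i j.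

Definition active_row (i : nat) : 'rV[int]_3 := \row_k (k \in active P i)%:R.

Lemma delta_yard_mx i j : delta_mx 0 j *m yard_mx i = V P i j.
Proof. by rewrite -rowE rowK. Qed.

Lemma active_row_yard_mx i : (active_row i *m yard_mx i) = \sum_(k in active P i) V P i k.
Proof.
rewrite mulmx_sum_row [RHS]big_mkcond; apply: eq_bigr => k _.
by rewrite rowK mxE; case: ifP; rewrite ?scale1r ?scale0r.
Qed.

Lemma V_step i j : (i < nsteps P)%N ->
  V P i.+1 j = (if j == step_index P i then active_row i else delta_mx 0 j) *m yard_mx i.
Proof.
by move=> lti /=; case: ifP; rewrite ?active_row_yard_mx ?delta_yard_mx.
Qed.

(** Coordinates on the earlier vertices of the vector with coordinates [u] on
    the vertices after the step. *)
Definition step_row i (u : 'rV[int]_3) : 'rV[int]_3 :=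
  \sum_j u 0 j *: (if j == step_index P i then active_row i else delta_mx 0 j).

Lemma step_rowP i u : (i < nsteps P)%N -> u *m yard_mx i.+1 = step_row i u *m yard_mx i.
Proof.
move=> lti; rewrite mulmx_sum_row mulmx_suml; apply: eq_bigr => j _.
by rewrite rowK V_step // scalemxAl.
Qed.

Lemma step_rowE i u k : (i < nsteps P)%N -> step_row i u 0 k =
  u 0 k + (if k == step_index P i then 0 else (k \in active P i)%:R * u 0 (step_index P i)).
Proof.
move=> lti; set c := step_index P i; rewrite /step_row summxE (bigD1 c) //= eqxx.
rewrite !mxE.
have -> : \sum_(j | j != c) (u 0 j *: (if j == c then active_row i else delta_mx 0 j)) 0 k
   = if k == c then 0 else u 0 k.
  rewrite (eq_bigr (fun j => u 0 j * (k == j)%:R)); last first.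
    by move=> j /negbTE ->; rewrite !mxE eqxx.
  case: eqVneq => [->|nk].
    by apply: big1 => j; rewrite eq_sym => /negbTE ->; rewrite mulr0.
  rewrite (bigD1 k) //= eqxx mulr1 big1 ?addr0 // => j /andP[_].
  by rewrite eq_sym => /negbTE ->; rewrite mulr0.
case: eqVneq => [->|_]; first by rewrite step_index_active // mulr1 !addr0.
by rewrite addrC mulrC.
Qed.

(** A step adds rows to another row, which is invertible: [step_row] leaves the
    coordinate at the step index [c] unchanged and adds multiples of it to the
    others. *)
Lemma yard_mx_inj i (u : 'rV[int]_3) : (i <= nsteps P)%N -> u *m yard_mx i = 0 -> u = 0.
Proof.
elim: i u => [|i IH] u lti.
  rewrite (_ : yard_mx 0 = 1%:M) ?mulmx1 //.
  by apply/row_matrixP => j; rewrite rowK row1.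
rewrite step_rowP // => /IH -/(_ (ltnW lti)) /rowP u0.
have E k := u0 k; set c := step_index P i.
have uc : u 0 c = 0 by have := E c; rewrite step_rowE // eqxx addr0 mxE.
apply/rowP => k; have := E k; rewrite step_rowE // -/c uc mulr0 if_same addr0.
by [].
Qed.

(** Going back one step only adds nonnegative terms to nonnegative coordinates,
    so the coordinate on [V_j] that starts as 1 never decreases. *)
Lemma V_later i i' (j : 'I_3) : (i <= i')%N -> (i' <= nsteps P)%N ->
  exists2 u : 'rV[int]_3, (forall k, (k == j)%:R <= u 0 k) & V P i' j = u *m yard_mx i.
Proof.
move=> le_ii' le_i'n.
suff H d : forall v : 'rV[int]_3, (forall k, 0 <= v 0 k) -> (i + d <= nsteps P)%N ->
   exists2 u : 'rV[int]_3, (forall k, v 0 k <= u 0 k) & v *m yard_mx (i + d) = u *m yard_mx i.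
  have [k||u ge] := H (i' - i)%N (delta_mx 0 j); first by rewrite mxE.
    by rewrite subnKC.
  rewrite subnKC // delta_yard_mx => e.
  by exists u => // k; have := ge k; rewrite mxE eqxx.
elim: d => [|d IH] v v0; first by move=> _; exists v; rewrite ?addn0.
rewrite addnS => lt; rewrite step_rowP //.
have ge k : v 0 k <= step_row (i + d) v 0 k.
  by rewrite step_rowE // lerDl; case: ifP => // _; rewrite mulr_ge0.
have [k||u geu ->] := IH (step_row (i + d) v); first exact: le_trans (ge k).
  exact: ltnW.
by exists u => // k; apply: le_trans (geu k).
Qed.

(** If the later point were the earlier [V_j], its coordinates would be those of
    a basis vector, with value 1 only at [j]; but the one at [j'] is positive. *)
Lemma V_disjoint i i' j j' : (i <= nsteps P)%N -> (i' <= nsteps P)%N ->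
  V P i j = V P i' j' -> j = j'.
Proof.
wlog le_ii' : i i' j j' / (i <= i')%N.
  by move=> W lei lei' e; case: (leqP i i') => [|/ltnW] /W H;
     [|symmetry]; apply: H => //.
move=> lei lei'; have [u ge ->] := V_later j' le_ii' lei'.
rewrite -delta_yard_mx => /eqP; rewrite -subr_eq0 -mulmxBl => /eqP /yard_mx_inj.
move=> /(_ lei) /rowP/(_ j'); have := ge j'; rewrite !mxE !eqxx /=.
by case: (eqVneq j' j) => [-> //|_] /= ge1 /eqP; rewrite subr_eq0 => /eqP e; move: ge1; rewrite -e.
Qed.

Lemma V_moves i j : (i < nsteps P)%N -> j = step_index P i -> V P i.+1 j != V P i j.
Proof.
move=> lti ej; apply/eqP; rewrite V_step // ej eqxx -delta_yard_mx => /eqP.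
rewrite -subr_eq0 -mulmxBl => /eqP /(yard_mx_inj (ltnW lti)) /rowP e.
have [k nk ka] := active_other P i (step_index P i).
by have := e k; rewrite !mxE ka (negbTE nk) andbF.
Qed.

Lemma farey_posE i v : (i < nsteps P)%N -> v \in simplex P i ->
  exists m, [/\ (m <= nsteps P)%N, farey_pos P v = V P m v.1
    & farey_pos P v \in mast P v.1].
Proof.
move=> lti; rewrite mem_simplex // => /andP[_ mv].
have [m lem ev] : exists2 m, (m <= nsteps P)%N & v.2 = moves P m v.1.
  case/orP: mv => [/eqP ev|/andP[_ /eqP ev]]; first by exists i; rewrite // ltnW.
  by exists i.+1.
have [lts e] := mast_nth v.1 lem; exists m; split=> //.
  by rewrite -e -ev; case: (v).
by rewrite mem_nth // ev.
Qed.

Lemma mem_mast_farey_pos i v k : (i < nsteps P)%N -> v \in simplex P i ->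
  (farey_pos P v \in mast P k) = (v.1 == k).
Proof.
move=> lti /(farey_posE lti)[m [lem e onv]]; apply/idP/eqP => [|<- //].
by move=> /mem_mast[m' lem']; rewrite e; apply: V_disjoint.
Qed.

(** Different masts are disjoint, and the only two vertices on one mast are the
    positions before and after the step. *)
Lemma farey_pos_inj i : (i < nsteps P)%N ->
  {in simplex P i &, injective (farey_pos P)}.
Proof.
move=> lti [j m] [k n] vS wS e.
have := mem_mast_farey_pos k lti vS; rewrite e (mem_mast_farey_pos k lti wS) eqxx /=.
move=> /esym/eqP ejk; move: vS wS e; rewrite {}ejk !mem_simplex //= => /andP[_ vm] /andP[_ wn].
have [_ e0] := mast_nth k (ltnW lti); have [_ e1] := mast_nth k lti.
case/orP: vm => [/eqP ->|/andP[/eqP ek /eqP ->]];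
  case/orP: wn => [/eqP ->|/andP[/eqP ek' /eqP ->]]; rewrite // ?e0 ?e1 => e.
  by have := V_moves lti ek'; rewrite e eqxx.
by have := V_moves lti ek; rewrite e eqxx.
Qed.

(** The count depends on the point sets of the simplex and of the mast alone, so
    it can be transported by maps of the ambient lattice. *)
Lemma farey_mast_count i j : (i < nsteps P)%N -> mast_count P i j =
  #|` [fset x in realize (farey_pos P) (simplex P i) | x \in mast P j]%fset|.
Proof.
move=> lti; rewrite /mast_count.
rewrite -(card_image_fset (f := farey_pos P)).
  congr #|` _|; apply/fsetP => x; rewrite in_fset_sep.
  apply/imfsetP/andP => [[v /= + ->]|[xj /imfsetP[v /= vS ex]]].
    rewrite in_fset_sep => /andP[vj vS]; rewrite (mem_mast_farey_pos _ lti) //; split=> //.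
    by apply/imfsetP; exists v.
  exists v => //=; rewrite in_fset_sep vS andbT -(mem_mast_farey_pos j lti vS).
  by rewrite -ex.
move=> v w /=; rewrite !in_fset_sep => /andP[_ vS] /andP[_ wS].
exact: farey_pos_inj vS wS.
Qed.

End Masts.

Lemma farey_mast_count_transport (P P' : cfrac) (g : 'rV[int]_3 -> 'rV[int]_3) :
  injective g ->
  [seq [fset g x | x in T]%fset | T : {fset 'rV[int]_3} <- farey_polyhedron P] =
    farey_polyhedron P' ->
  (forall j x, (g x \in mast P' j) = (x \in mast P j)) ->
  nsteps P = nsteps P' /\
  forall i, (i < nsteps P)%N -> mast_count P i =1 mast_count P' i.
Proof.
move=> g_inj e gm; have en : nsteps P = nsteps P'.
  by have := congr1 size e; rewrite !size_map !size_iota.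
split=> // i lti j; rewrite !farey_mast_count -?en //.
have := congr1 (fun s => nth fset0 s i) e; rewrite /farey_polyhedron -map_comp.
rewrite !(nth_map 0%N) ?size_iota -?en // !nth_iota -?en // add0n /= => <-.
set S := realize _ _; rewrite -[LHS](card_image_fset (f := g)); last exact: in2W.
congr #|` _|; apply/fsetP => y; rewrite in_fset_sep.
apply/imfsetP/andP => [[x /= + ->]|[yj /imfsetP[x /= xS ex]]].
  rewrite in_fset_sep gm => /andP[-> xS]; split=> //; by apply/imfsetP; exists x.
by exists x => //=; rewrite in_fset_sep xS -gm -ex yj.
Qed.

(** * Integer affine maps *)

Section IntegerAffine.
Variable R : realType.

Lemma toR_inj : injective (@toR R).
Proof.
move=> x y /matrixP e; apply/matrixP => i j; have := e i j.
by rewrite !mxE; exact: intr_inj.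
Qed.

Section Map.
Variable f : 'rV[R]_3 -> 'rV[R]_3.
Hypothesis f_aff : integer_affine f.

Lemma integer_affine_int z : exists z', f (toR R z) = toR R z'.
Proof.
case: f_aff => _ fZ; have : (f @` range (@toR R))%classic (f (toR R z)).
  by exists (toR R z) => //; exists z.
by rewrite fZ => -[z' _ e]; exists z'.
Qed.

Lemma integer_affine_onto z : exists z', f (toR R z') = toR R z.
Proof.
case: f_aff => _ fZ; have : range (@toR R) (toR R z) by exists z.
by rewrite -fZ => -[_ [z' _ <-] e]; exists z'.
Qed.

(** Since the lattice is hit, every basis vector is in the row space of the
    linear part, which is therefore invertible. *)
Lemma integer_affine_inj : injective f.
Proof.
have [[A [b fE]] _] := f_aff.
have [b0 fb] := integer_affine_int 0.
have toR0 : toR R 0 = 0 by apply/rowP => k; rewrite !mxE.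
have {fb} eb : b = toR R b0 by rewrite -fb fE toR0 mul0mx add0r.
have A_unit : A \in unitmx.
  rewrite -row_full_unit -sub1mx; apply/row_subP => j; rewrite row1.
  (* [b0] compensates the translation part of [f]. *)
  have [z fz] := integer_affine_onto (delta_mx 0 j + b0); apply/submxP.
  exists (toR R z); have := fz; rewrite fE eb {1}/toR => e.
  have -> : delta_mx 0 j = toR R (delta_mx 0 j + b0) - toR R b0 :> 'rV[R]_3.
    by apply/rowP => k; rewrite !mxE rmorphD /= addrK rmorph_nat.
  by rewrite -e addrK.
move=> x y; rewrite !fE => /addIr e.
by rewrite -(mulmxK A_unit x) e mulmxK.
Qed.

End Map.

Lemma maps_farey_mast_count (f : 'rV[R]_3 -> 'rV[R]_3) (P P' : cfrac) :
  integer_affine f -> maps_farey f P P' ->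
  nsteps P = nsteps P' /\
  forall i, (i < nsteps P)%N -> mast_count P i =1 mast_count P' i.
Proof.
move=> f_aff [eS eM]; have f_inj := integer_affine_inj f_aff.
have [g fg] := choice (integer_affine_int f_aff).
have g_inj : injective g.
  by move=> x y e; apply/toR_inj/f_inj; rewrite !fg e.
apply: (farey_mast_count_transport g_inj) => [|j x]; last first.
  have eMj := eM j; apply/idP/idP => [gx|xm].
    have : (toR R @` [set` mast P' j])%classic (toR R (g x)) by exists (g x).
    by rewrite -eMj -fg => -[_ [y ym <-] /f_inj/toR_inj <-].
  have : (f @` (toR R @` [set` mast P j]))%classic (f (toR R x)).
    by exists (toR R x) => //; exists x.
  by rewrite eMj fg => -[y ym /toR_inj <-].
have en : size (farey_polyhedron P) = size (farey_polyhedron P').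
  by have := congr1 size eS; rewrite !size_map.
apply: (@eq_from_nth _ fset0) => [|i]; rewrite size_map // => lti.
have := congr1 (fun s => nth set0 s i) eS; rewrite !(nth_map fset0) -?en //.
move: (nth _ _ i) (nth _ _ i) => T' T eT; apply/fsetP => y.
apply/imfsetP/idP => [[x /= xT ->]|yT'].
  have : (f @` (toR R @` [set` T]))%classic (f (toR R x)).
    by exists (toR R x) => //; exists x.
  by rewrite eT fg => -[z zT' /toR_inj <-].
have : (toR R @` [set` T'])%classic (toR R y) by exists y.
by rewrite -eT => -[_ [x xT <-]]; rewrite fg => /toR_inj <-; exists x.
Qed.

End IntegerAffine.

Theorem theorem3p56 (R : realType) (P P' : cfrac) :
  (prismatic_diagram P = prismatic_diagram P' ->
     forall j : 'I_3, LLS R P j = LLS R P' j) /\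
  (forall f : 'rV[R]_3 -> 'rV[R]_3,
     integer_affine f -> maps_farey f P P' ->
     forall j : 'I_3, LLS R P j = LLS R P' j).
Proof.
split=> [/prismatic_mast_count[en ec] j|f f_aff /(maps_farey_mast_count f_aff)[en ec] j];
  exact: LLS_determined.
Qed.
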